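(* For $0\le s\le 2$ and every integer $n\ge 0$, $$R_3(s,3,3n+2)=\frac{\overline{pp}(3n+2)}{3}.$$
   Context: An overpartition of $n$ is a partition of $n$ in which the first occurrence of each number may be overlined; there is exactly one overpartition of $0$ (the empty one). An overpartition pair of $n$ is an ordered pair $\pi=(\lambda,\mu)$ of overpartitions such that the sum of all parts of $\lambda$ and $\mu$ is $n$ (either may be the overpartition of $0$). $\overline{pp}(n)$ denotes the number of overpartition pairs of $n$. For an overpartition $\lambda$, $n_3(\lambda)$ denotes the number of non-overlined parts of $\lambda$ (counted with multiplicity). For an overpartition pair $\pi=(\lambda,\mu)$, define $r_3(\pi)=n_3(\lambda)-n_3(\mu)$ (so the empty pair of $0$ has $r_3=0$). $R_3(s,t,n)$ is the number of overpartition pairs $\pi$ of $n$ with $r_3(\pi)\equiv s\pmod t$. *)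

(* Defs.v *)
From mathcomp Require Import all_boot all_order all_algebra.

Set Implicit Arguments.
Unset Strict Implicit.
Unset Printing Implicit Defensive.

(* A part (m, b) has size m and is overlined iff b = true. *)
Definition part : Type := (nat * bool)%type.

(* Parts are listed in non-increasing order of size; among equal sizes only the
   first listed part may be overlined, so that each overpartition is exactly
   one sequence. *)
Definition part_rel : rel part :=
  [rel x y : part | (y.1 < x.1) || (y.1 == x.1) && ~~ y.2].

Definition is_overpartition (l : seq part) : bool :=
  all (fun x : part => 0 < x.1) l && sorted part_rel l.

Definition weight (l : seq part) : nat := sumn [seq x.1 | x <- l].

Definition is_overpartition_pair (n : nat) (p : seq part * seq part) : bool :=
  [&& is_overpartition p.1, is_overpartition p.2
    & weight p.1 + weight p.2 == n].

Definition n3 (l : seq part) : nat := count (fun x : part => ~~ x.2) l.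

Definition r3 (p : seq part * seq part) : int :=
  ((n3 p.1)%:Z - (n3 p.2)%:Z)%R.

Fixpoint words (T : Type) (A : seq T) (k : nat) : seq (seq T) :=
  if k is k'.+1 then [::] :: [seq x :: w | x <- A, w <- words A k']
  else [:: [::]].

(* Members of a pair of weight n have at most n parts, all of size at most n,
   so filtering this finite list of candidates misses nothing: see
   overpartition_pairs_uniq and mem_overpartition_pairs. *)
Definition overpartition_pairs (n : nat) : seq (seq part * seq part) :=
  let W := words [seq (m, b) | m <- iota 1 n, b <- [:: false; true]] n in
  [seq p <- [seq (l, m) | l <- W, m <- W] | is_overpartition_pair n p].

Definition pp (n : nat) : nat := size (overpartition_pairs n).

Definition R3 (s t n : nat) : nat :=
  count (fun p => (r3 p == s%:Z %[mod t%:Z])%Z) (overpartition_pairs n).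

Lemma words_uniq (T : eqType) (A : seq T) k : uniq A -> uniq (words A k).
Proof.
move=> uA; elim: k => //= k IHk; apply/andP; split.
  by apply/negP => /allpairsP [[x w] [_ _]].
by apply: allpairs_uniq => // -[x w] [y v] _ _ /= [-> ->].
Qed.

Lemma mem_words (T : eqType) (A : seq T) k w :
  (w \in words A k) = (size w <= k) && all [in A] w.
Proof.
elim: k w => [|k IHk] [|x w] //=; rewrite inE /= ltnS andbCA -IHk.
apply/allpairsP/andP => [[[y v] [/= yA vW [-> ->]]] // | [xA wW]].
by exists (x, w).
Qed.

Lemma overpartition_pairs_uniq n : uniq (overpartition_pairs n).
Proof.
have uA : uniq [seq (m, b) | m <- iota 1 n, b <- [:: false; true]].
  by apply: allpairs_uniq => //; [exact: iota_uniq | case=> ? ? [? ?] _ _ /= [-> ->]].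
apply: filter_uniq; apply: allpairs_uniq; try exact: words_uniq.
by case=> ? ? [? ?] _ _ /= [-> ->].
Qed.

Lemma mem_overpartition_pairs n p :
  (p \in overpartition_pairs n) = is_overpartition_pair n p.
Proof.
have inW l : is_overpartition l -> weight l <= n ->
    l \in words [seq (m, b) | m <- iota 1 n, b <- [:: false; true]] n.
  case/andP=> /allP l_gt0 _ le_n; rewrite mem_words; apply/andP; split.
    apply: leq_trans le_n; rewrite -sum1_size /weight sumnE big_map.
    by rewrite !big_seq; apply: leq_sum => x /l_gt0.
  apply/allP=> -[m b] xl; apply/allpairsP; exists (m, b); split=> //=.
    rewrite mem_iota add1n ltnS (l_gt0 _ xl) /=; apply: leq_trans le_n.
    by rewrite /weight sumnE big_map (big_rem _ xl) /= leq_addr.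
  by case: b {xl}.
rewrite mem_filter; case: (boolP (is_overpartition_pair n p)) => //=.
case: p => l m /and3P [/= ol om /eqP wn].
apply/allpairsP; exists (l, m); split=> //=; apply: inW => //.
  by rewrite -wn leq_addr.
by rewrite -wn leq_addl.
Qed.

(* Main.v *)
Require Import Defs.
From mathcomp Require Import all_boot all_order all_algebra all_field.
From mathcomp Require Import zify ring.

Set Implicit Arguments.
Unset Strict Implicit.
Unset Printing Implicit Defensive.
Import GRing.Theory Num.Theory.
Local Open Scope ring_scope.

(** Weight a pair [(l, u)] by [w ^ (n3 l - n3 u)], where [w] is a primitive cube
    root of unity.  The overpartitions counted by plain parts have generating
    function [prod (1 + q^i) / (1 - z q^i)], so the pairs have
      [prod (1 + q^i)^2 / ((1 - w q^i) (1 - w^2 q^i))]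
      [= prod (1 + q^i)^2 (1 - q^i) / prod (1 - q^(3i))],
    because [(1 - x) (1 - w x) (1 - w^2 x) = 1 - x^3].  By Gauss's identity
    the numerator is the sum of [q^(j(j+1)/2)] over [j >= 0].  No triangular
    number is 2 modulo 3, and the denominator is a series in [q^3], so the
    coefficient of [q^(3n+2)] vanishes: [a + b w + c w^2 = 0], where [a], [b], [c]
    count the pairs of the three residues.  The same holds for [w^2] in place of
    [w], and the two relations force [a = b = c].

    Everything is done with polynomials modulo a power of ['X], denominators
    being multiplied out.  The sum over pairs becomes a product of polynomials
    because overpartitions are enumerated one part size at a time, with a cap on
    the number of equal plain parts that only affects exponents beyond the
    truncation order ([perm_overpartition_pairs], [gf_capped]).  Gauss's identity
    ([gauss_triangular]) comes from Shanks' polynomial identity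
    ([shanks_triangular]), which telescopes.  [gf_cubic_triangular] joins the
    two, and [coef_cubic_quotient] removes the series in [q^3]. *)

(** * Enumerating overpartitions by blocks *)

Definition cats (s t : seq (seq part)) := [seq a ++ b | a <- s, b <- t].

Definition overlined_blocks m : seq (seq part) := [:: [::]; [:: (m, true)]].

Definition plain_blocks r m : seq (seq part) :=
  [seq nseq j (m, false) | j <- iota 0 r.+1].

(** The overpartitions with parts at most [m] in which no plain part is
    repeated more than [r] times.  The cap keeps the list finite for all weights
    at once, so that its generating function factors exactly. *)
Fixpoint capped r m :=
  if m is m'.+1 then
    cats (cats (overlined_blocks m) (plain_blocks r m)) (capped r m')
  else [:: [::]].

Lemma weight_cat a b : weight (a ++ b) = (weight a + weight b)%N.
Proof. by rewrite /weight map_cat sumn_cat. Qed.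

Lemma n3_cat a b : n3 (a ++ b) = (n3 a + n3 b)%N.
Proof. exact: count_cat. Qed.

Lemma weight_nseq j m b : weight (nseq j (m, b)) = (j * m)%N.
Proof. by rewrite /weight map_nseq sumn_nseq mulnC. Qed.

Lemma part_rel_trans : transitive part_rel.
Proof.
move=> [y b] [x a] [z c]; rewrite /part_rel /= => /orP[yx | /andP[/eqP -> _]] //.
by case/orP => [zy | /andP[/eqP -> _]]; rewrite ?yx // (ltn_trans zy yx).
Qed.

Lemma capped_sound r m l : l \in capped r m ->
  is_overpartition l && all (fun x : part => x.1 <= m)%N l.
Proof.
rewrite /is_overpartition (sorted_pairwise part_rel_trans).
elim: m l => [|m IHm] l /=; first by rewrite inE => /eqP->.
case/allpairsP => -[a t] [/= /allpairsP [[o p] [/= o_in p_in ->]] /IHm t_in ->].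
case/mapP: p_in => j _ ->.
case/andP: t_in => /andP [t_pos t_pw] t_le.
have j_pw : pairwise part_rel (nseq j (m.+1, false)).
  by elim: j => //= j ->; rewrite all_nseq /part_rel /= eqxx !orbT.
have t_le' : all (fun x : part => x.1 <= m.+1)%N t.
  by apply: sub_all t_le => x /leqW.
rewrite -catA !all_cat !pairwise_cat allrel_catr t_pos t_pw t_le' j_pw /=.
have blk_t b : all (part_rel (m.+1, b)) t.
  by apply: sub_all t_le => x; rewrite /part_rel /= ltnS => ->.
have -> : allrel part_rel (nseq j (m.+1, false)) t.
  by apply/allrelP => x y /nseqP [-> _] /(allP (blk_t false)).
rewrite !all_nseq /= leqnn !orbT.
move: o_in; rewrite !inE => /orP[] /eqP -> //=.
by rewrite !allrel1l all_nseq blk_t /part_rel /= eqxx leqnn !orbT.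
Qed.

(** Only the first occurrence of the largest size can be overlined, so the parts
    of that size form an initial run with at most one overlined part, in front. *)
Lemma split_top_block m l : pairwise part_rel l ->
    all (fun x : part => x.1 <= m.+1)%N l ->
  exists o j t, [/\ l = (o ++ nseq j (m.+1, false)) ++ t,
     o \in overlined_blocks m.+1 & all (fun x : part => x.1 <= m)%N t].
Proof.
elim: l => [|[i b] l IHl] /=; first by exists [::], 0, [::].
case/andP => x_l /IHl{}IHl /andP [le_i /IHl [o [j [t [def_l o_in t_le]]]]].
move: o_in x_l; rewrite def_l !inE !all_cat all_nseq.
case/orP => /eqP->.
  case/andP => x_j x_t; case: (ltngtP i m.+1) le_i => // [lt_i|->] _.
    exists [::], 0, ((i, b) :: t); split => //=; last by rewrite t_le -ltnS lt_i.
    by have -> : j = 0 by move: x_j; rewrite /part_rel /=; lia.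
  case: b {x_j x_t}; last by exists [::], j.+1, t.
  by exists [:: (m.+1, true)], j, t; split; rewrite ?inE ?eqxx ?orbT.
case/andP => /andP [/andP [x_o _] _] _.
by move: x_o; rewrite /part_rel /= andbF orbF ltnNge le_i.
Qed.

Lemma capped_complete r m l : is_overpartition l ->
    all (fun x : part => x.1 <= m)%N l -> (weight l <= r)%N -> l \in capped r m.
Proof.
rewrite /is_overpartition (sorted_pairwise part_rel_trans).
elim: m l => [|m IHm] l /=.
  by case: l => [|x l] //= /andP [/andP [x_gt0 _] _] /andP []; rewrite leqNgt x_gt0.
case/andP => l_pos l_pw l_le.
have [o [j [t [def_l o_in t_le]]]] := split_top_block l_pw l_le.
move: l_pos l_pw; rewrite def_l all_cat pairwise_cat => /andP [_ t_pos] /and3P [_ _ t_pw].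
rewrite !weight_cat weight_nseq => le_r.
apply: allpairs_f; last by apply: IHm; rewrite ?t_pos //; lia.
apply: allpairs_f => //; apply/mapP; exists j => //.
rewrite mem_iota; nia.
Qed.

Lemma capped_uniq r m : uniq (capped r m).
Proof.
elim: m => [|m IHm] //.
change (uniq (cats (cats (overlined_blocks m.+1) (plain_blocks r m.+1)) (capped r m))).
apply: allpairs_uniq => //.
  apply: allpairs_uniq => //.
    rewrite map_inj_uniq ?iota_uniq // => i j /(congr1 size).
    by rewrite !size_nseq.
  move=> x y /allpairsP [[o p] op] /allpairsP [[o' p'] op'].
  case: op op' => [/= o_in /mapP [j _ ->] ->] [/= o'_in /mapP [j' _ ->] ->].
  move: o_in o'_in; rewrite !inE /= => /orP[] /eqP-> /orP[] /eqP-> //=.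
  - by move=> ->.
  - by case: j.
  - by case: j'.
  - by case=> ->.
(* The parts of the largest size recover the leading block of a list. *)
have top s t : s \in cats (overlined_blocks m.+1) (plain_blocks r m.+1) ->
    t \in capped r m -> [seq x <- s ++ t | x.1 == m.+1] = s.
  move=> /allpairsP [[o p] [/= o_in /mapP [j _ ->] ->]] /capped_sound/andP [_ t_le].
  rewrite !filter_cat filter_nseq /= eqxx mul1n.
  rewrite (_ : [seq x <- t | _] = [::]) ?cats0; last first.
    by apply/eqP; rewrite -[_ == _]negbK -has_filter; apply/hasPn => x /(allP t_le); lia.
  by move: o_in; rewrite !inE => /orP[] /eqP-> //=; rewrite eqxx.
move=> x y /allpairsP [[s t] st] /allpairsP [[s' t'] st'].
case: st st' => [/= s_in t_in ->] [/= s'_in t'_in ->] eq_st.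
have eq_s : s = s' by rewrite -(top _ _ s_in t_in) eq_st top.
by move: eq_st; rewrite eq_s => /eqP; rewrite eqseq_cat // eqxx => /eqP ->.
Qed.

(** In a pair of weight [n] there are at most [n] parts, of size at most [n], so
    for [r] and [m] at least [n] the two bounds exclude nothing. *)
Lemma perm_overpartition_pairs r m n : (n <= r)%N -> (n <= m)%N ->
  perm_eq (overpartition_pairs n)
    [seq p <- [seq (l, u) | l <- capped r m, u <- capped r m]
       | (weight p.1 + weight p.2 == n)%N].
Proof.
move=> le_nr le_nm; apply: uniq_perm.
- exact: overpartition_pairs_uniq.
- by apply: filter_uniq; apply: allpairs_uniq; rewrite ?capped_uniq // => -[? ?] [? ?] _ _.
have parts_le l : (weight l <= n)%N -> all (fun x : part => x.1 <= m)%N l.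
  move=> w_le; apply/allP => x x_in; apply: leq_trans le_nm; apply: leq_trans w_le.
  by rewrite /weight sumnE big_map (big_rem _ x_in) leq_addr.
case=> l u; rewrite mem_overpartition_pairs mem_filter /is_overpartition_pair /= andbA andbC.
case: eqP => //= w_n; apply/andP/allpairsP => [[l_op u_op] | [[a b] [/= + + [-> ->]]]].
  by exists (l, u); split=> //=; apply: capped_complete => //; try apply: parts_le; lia.
by move=> /capped_sound/andP [-> _] /capped_sound/andP [-> _].
Qed.

(** * Generating functions *)

Section GeneratingFunction.
Variable F : fieldType.

Definition gf (z : F) (s : seq (seq part)) : {poly F} :=
  \sum_(l <- s) z ^+ n3 l *: 'X^(weight l).

Lemma gf_cats z s t : gf z (cats s t) = gf z s * gf z t.
Proof.
rewrite /gf big_allpairs_dep mulr_suml; apply: eq_bigr => a _.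
rewrite mulr_sumr; apply: eq_bigr => b _.
by rewrite n3_cat weight_cat !exprD -scalerAl -scalerAr scalerA.
Qed.

Lemma gf_plain z r m :
  gf z (plain_blocks r m) = \sum_(j < r.+1) (z *: 'X^m) ^+ j.
Proof.
rewrite /gf big_map -[iota 0 r.+1]/(index_iota 0 r.+1) big_mkord.
apply: eq_bigr => j _.
by rewrite /n3 count_nseq mul1n weight_nseq exprZn -exprM mulnC.
Qed.

Lemma gf_capped z r m : gf z (capped r m) =
  \prod_(1 <= i < m.+1) ((1 + 'X^i) * \sum_(j < r.+1) (z *: 'X^i) ^+ j).
Proof.
elim: m => [|m IHm]; first by rewrite /gf /= big_geq // big_seq1 scale1r.
rewrite big_nat_recr //= -IHm !gf_cats gf_plain mulrC; congr (_ * (_ * _)).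
by rewrite /gf big_cons big_seq1 /n3 /weight /= !expr0 !scale1r addn0.
Qed.

Lemma coef_gf_mul (z w : F) s t n : (gf z s * gf w t)`_n =
  \sum_(p <- [seq p <- [seq (l, u) | l <- s, u <- t]
       | (weight p.1 + weight p.2 == n)%N]) z ^+ n3 p.1 * w ^+ n3 p.2.
Proof.
rewrite big_filter big_mkcond big_allpairs_dep /= /gf mulr_suml coef_sum.
apply: eq_bigr => l _; rewrite mulr_sumr coef_sum; apply: eq_bigr => u _.
rewrite -scalerAl -scalerAr scalerA -exprD coefZ coefXn eq_sym.
by case: eqP => _; rewrite ?mulr1 ?mulr0.
Qed.

End GeneratingFunction.

(** * Shanks' finite form of Gauss's triangular-number identity *)

(** The infinite identity is
    [sum q^(j(j+1)/2) = prod (1 - q^(2i)) / (1 - q^(2i-1))].  Shanks' partial sums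
    of its left side, multiplied by the odd factors, are the polynomials
    [shanks n], whose terms of index [s > 0] are divisible by [q^(2n+1)]. *)
Section Shanks.
Variables (A : comPzRingType) (q : A).

Definition evens s n := \prod_(s <= i < n) (1 - q ^+ (2 * i).+2).
Definition odds n := \prod_(0 <= i < n) (1 - q ^+ (2 * i).+1).
Definition triangular k := \sum_(0 <= j < k) q ^+ 'C(j.+1, 2).
Definition shanks n :=
  \sum_(0 <= s < n) q ^+ (s * (2 * n).+1) * evens s n * odds s.

(** The summand on the left is [v (s + 1) - v s], where [v k] is the right-hand
    side, and [v 0 = 0]. *)
Lemma shanks_telescope n k : (k <= n)%N ->
  \sum_(0 <= s < k) (q ^+ (s * (2 * n.+1).+1) * evens s n.+1 * odds s
     - (1 - q ^+ (2 * n).+1) * (q ^+ (s * (2 * n).+1) * evens s n * odds s))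
  = q ^+ (k * (2 * n).+1) * (1 - q ^+ (2 * k)) * evens k n * odds k.
Proof.
elim: k => [|k IHk] lekn; first by rewrite big_geq // muln0 expr0 subrr mulr0 !mul0r.
rewrite big_nat_recr //= IHk ?(ltnW lekn) //.
have -> : evens k n.+1 = evens k n * (1 - q ^+ (2 * n).+2).
  by rewrite /evens big_nat_recr // ltnW.
have -> : evens k n = (1 - q ^+ (2 * k).+2) * evens k.+1 n.
  by rewrite /evens big_ltn.
have -> : odds k.+1 = odds k * (1 - q ^+ (2 * k).+1).
  by rewrite /odds big_nat_recr.
have -> : (k * (2 * n.+1).+1 = k * (2 * n).+1 + 2 * k)%N by lia.
have -> : (k.+1 * (2 * n).+1 = k * (2 * n).+1 + (2 * n).+1)%N by lia.
have -> : (2 * k.+1 = (2 * k).+2)%N by lia.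
move: (k * (2 * n).+1)%N (2 * k)%N (2 * n)%N (evens k.+1 n) (odds k) => a b c d e.
rewrite !exprD !exprS; ring.
Qed.

(** Passing from [n] to [n + 1] multiplies the sum by [1 - q^(2n+1)] up to the
    boundary term of the telescoping and the new last summand; together these
    supply the two new triangular powers. *)
Lemma shanks_triangular n : shanks n = odds n * triangular (2 * n).
Proof.
elim: n => [|n IHn].
  by rewrite /shanks /triangular !big_geq // mulr0.
have := shanks_telescope (leqnn n); rewrite sumrB -mulr_sumr -/(shanks n) IHn.
move/(canRL (subrK _)) => tel.
rewrite /shanks big_nat_recr //= tel.
have -> : evens n n.+1 = 1 - q ^+ (2 * n).+2 by rewrite /evens big_nat1.
have -> : evens n n = 1 by rewrite /evens big_geq.
have -> : odds n.+1 = odds n * (1 - q ^+ (2 * n).+1).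
  by rewrite /odds big_nat_recr.
have -> : triangular (2 * n.+1) =
    triangular (2 * n) + q ^+ (n * (2 * n).+1) * (1 + q ^+ (2 * n).+1).
  have -> : (2 * n.+1 = (2 * n).+2)%N by lia.
  rewrite /triangular 2?big_nat_recr //= -addrA; congr (_ + _).
  have bin_odd : 'C((2 * n).+1, 2) = (n * (2 * n).+1)%N.
    by rewrite bin2 /= mulnC -mulnA mul2n doubleK.
  by rewrite bin_odd (binS (2 * n).+1) bin_odd bin1 exprD mulrDr mulr1.
have -> : (n * (2 * n.+1).+1 = n * (2 * n).+1 + 2 * n)%N by lia.
move: (n * (2 * n).+1)%N (2 * n)%N (odds n) (triangular (2 * n)) => a b c d.
rewrite !exprD !exprS; ring.
Qed.
End Shanks.

(** * Polynomials modulo a power of the variable *)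

Section Truncation.
Variable F : fieldType.

Definition eqX k (p q : {poly F}) := 'X^k %| p - q.

Lemma eqX_refl k p : eqX k p p. Proof. by rewrite /eqX subrr dvdp0. Qed.

Lemma eqX_trans k q p s : eqX k p q -> eqX k q s -> eqX k p s.
Proof. by move=> pq /(dvdp_add pq); rewrite addrA subrK. Qed.

Lemma eqX_mul k p p' q q' : eqX k p p' -> eqX k q q' -> eqX k (p * q) (p' * q').
Proof.
move=> pp qq; rewrite /eqX.
rewrite (_ : _ - _ = (p - p') * q + p' * (q - q')); last by ring.
exact: (dvdp_add (dvdp_mulr _ pp) (dvdp_mull _ qq)).
Qed.

Lemma eqX_prod k m n (f g : nat -> {poly F}) :
  (forall i, m <= i < n -> eqX k (f i) (g i))%N ->
  eqX k (\prod_(m <= i < n) f i) (\prod_(m <= i < n) g i).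
Proof.
move=> fg; rewrite big_nat [X in eqX _ _ X]big_nat.
apply: (big_ind2 (eqX k)) => //; first exact: eqX_refl.
by move=> *; apply: eqX_mul.
Qed.

(** A polynomial with constant term 1 is coprime to ['X]. *)
Lemma eqX_cancel k (e p q : {poly F}) : e`_0 = 1 -> eqX k (e * p) (e * q) -> eqX k p q.
Proof.
move=> e0; rewrite /eqX -mulrBr Gauss_dvdpr //.
apply: coprimep_expl; rewrite coprimep_sym coprimepX rootE horner_coef0 e0.
exact: oner_neq0.
Qed.

Lemma eqX_coef k (p q : {poly F}) i : eqX k p q -> (i < k)%N -> p`_i = q`_i.
Proof.
by move=> /dvdpP [c def] lt_ik; apply/eqP; rewrite -subr_eq0 -coefB def coefMXn lt_ik.
Qed.

(** Division by a series in [q^3] does not mix residue classes of exponents.  The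
    coefficient of [g] at [3n+2] is determined by that of [t] and by those of [g]
    at smaller exponents of the same class, whence the induction. *)
Lemma coef_cubic_quotient k (g h t : {poly F}) :
  h`_0 = 1 -> eqX k (g * (h \Po 'X^3)) t ->
  (forall n, (3 * n + 2 < k)%N -> t`_(3 * n + 2) = 0) ->
  forall n, (3 * n + 2 < k)%N -> g`_(3 * n + 2) = 0.
Proof.
move=> h0 gh t0; elim/ltn_ind => n IHn lt_nk.
have := eqX_coef gh lt_nk; rewrite t0 // coefM big_ord_recr /= subnn.
rewrite coef_comp_poly_Xn // dvdn0 div0n h0 mulr1 big1 ?add0r // => i _.
rewrite coef_comp_poly_Xn //; case: ifP => [/dvdnP [c def_c]|]; last by rewrite mulr0.
have lt_i := ltn_ord i.
have def_i : (i = 3 * (n - c) + 2 :> nat)%N by lia.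
by rewrite def_i IHn ?mul0r //; lia.
Qed.

End Truncation.

(** * Gauss's identity and the cubic specialisation *)

Section Cubic.
Variable F : fieldType.

(** Let [P] be the product of the [1 + q^i], [D] that of the odd [1 - q^i] and
    [E] that of the even ones.  Modulo [q^(2m+1)], [P * (D * E)] is the product of
    the [1 - q^(2i)], that is [E], so [P * D = 1] (Euler).  Hence
    [P^2 * (D * E) = P * E = P * D * T = T], with [E = D * T] by Shanks.
    For [m = 0] the sum [T] is empty and the congruence fails. *)
Lemma gauss_triangular m : (0 < m)%N -> eqX (2 * m).+1
  (\prod_(1 <= i < (2 * m).+1) (1 + 'X^i) ^+ 2 * \prod_(1 <= i < (2 * m).+1) (1 - 'X^i))
  (triangular ('X : {poly F}) (2 * m)).
Proof.
move=> m_gt0; set k := (2 * m).+1.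
pose Pp : {poly F} := \prod_(1 <= i < k) (1 + 'X^i).
pose Pm : {poly F} := \prod_(1 <= i < k) (1 - 'X^i).
rewrite prodrXl -/Pp -/Pm.
pose E : {poly F} := evens 'X 0 m; pose D : {poly F} := odds 'X m.
have Pm_E : Pm = D * E.
  rewrite /Pm /k /D /E /odds /evens; elim: (m) => [|j IHj].
    by rewrite !big_geq ?mulr1.
  have -> : (2 * j.+1 = (2 * j).+2)%N by lia.
  rewrite (@big_nat_recr _ _ _ (2 * j).+2) // (@big_nat_recr _ _ _ (2 * j).+1) // IHj.
  rewrite !(@big_nat_recr _ _ _ j) //=; ring.
have E_D : eqX k E (D * triangular 'X (2 * m)).
  rewrite -shanks_triangular /shanks /k; case: m m_gt0 @E {Pp Pm Pm_E k D} => // n _ E.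
  rewrite big_ltn // mul0n expr0 mul1r {1}/odds big_geq // mulr1.
  rewrite /eqX opprD addrA subrr add0r dvdpNr big_nat.
  apply: (big_ind (fun p => 'X^_ %| p)); first exact: dvdp0.
    by move=> *; rewrite dvdp_add.
  by move=> i /andP [i_gt0 _]; rewrite -mulrA dvdp_mulr // dvdp_exp2l // leq_pmull.
have PpPm : eqX k (Pp * Pm) E.
  rewrite -big_split /=.
  rewrite (eq_bigr (fun i => 1 - 'X^(2 * i) : {poly F})); last first.
    by move=> i _; rewrite mulnC exprM; ring.
  (* The factors 1 - X^(2i) with i > m are 1 modulo X^k. *)
  rewrite /k big_add1 /= (@big_cat_nat _ _ _ m) //=; last by lia.
  rewrite /E /evens -[X in eqX _ _ X]mulr1; apply: eqX_mul.
    rewrite (eq_bigr (fun i => 1 - 'X^((2 * i).+2) : {poly F})); first exact: eqX_refl.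
    by move=> i _; rewrite mulnS.
  rewrite [X in eqX _ _ X](_ : 1 = \prod_(m <= i < 2 * m) 1); last by rewrite big1_eq.
  apply: eqX_prod => i /andP [le_mi _].
  rewrite /eqX addrAC subrr add0r dvdpNr dvdp_exp2l //; lia.
have E0 : E`_0 = 1.
  rewrite -horner_coef0 /E /evens horner_prod big1 // => i _.
  by rewrite !hornerE /= expr0n subr0.
have PpD : eqX k (Pp * D) 1.
  apply: (eqX_cancel E0).
  by rewrite mulr1 mulrC -mulrA -Pm_E.
apply: (@eqX_trans _ _ (Pp * E)).
  by rewrite expr2 -mulrA; apply: eqX_mul => //; apply: eqX_refl.
apply: (@eqX_trans _ _ (Pp * (D * triangular 'X (2 * m)))).
  by apply: eqX_mul => //; apply: eqX_refl.
rewrite mulrA -[X in eqX _ _ X]mul1r.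
by apply: eqX_mul => //; apply: eqX_refl.
Qed.

(** If [3n + 2 = j(j+1)/2] then [j(j+1)] is 1 modulo 3; it is 0 or 2. *)
Lemma coef_triangular k n : (triangular ('X : {poly F}) k)`_(3 * n + 2) = 0.
Proof.
rewrite coef_sum big1 // => j _; rewrite coefXn; case: eqP => // bin_j.
have := mul_bin_diag j.+1 1; rewrite -bin_j bin1 /= (divn_eq j 3).
have := ltn_pmod j (isT : (0 < 3)%N).
by case: (j %% 3)%N (j %/ 3)%N => [|[|[|]]] // a _; lia.
Qed.

Lemma cube_root_of_unity (w : F) : 1 + w + w ^+ 2 = 0 -> w ^+ 3 = 1.
Proof.
move=> w0; apply/eqP; rewrite -subr_eq0; apply/eqP.
by transitivity ((w - 1) * (1 + w + w ^+ 2)); [ring | rewrite w0 mulr0].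
Qed.

(** The cap [2 * m] makes each geometric sum an inverse of [1 - z q^i] modulo
    [q^(2m+1)]; the factors [1 - q^(3i)] then cancel both denominators and leave
    [1 - q^i]. *)
Lemma gf_cubic_triangular (w : F) m : (0 < m)%N -> 1 + w + w ^+ 2 = 0 ->
  eqX (2 * m).+1
    (gf w (capped (2 * m) (2 * m)) * gf (w ^+ 2) (capped (2 * m) (2 * m))
      * ((\prod_(1 <= i < (2 * m).+1) (1 - 'X^i)) \Po 'X^3))
    (triangular 'X (2 * m)).
Proof.
move=> m_gt0 w0; set M := (2 * m)%N.
rewrite !gf_capped -!big_split /= rmorph_prod /= -big_split /=.
apply: eqX_trans (gauss_triangular m_gt0); rewrite -big_split /=.
apply: eqX_prod => i /andP [i_gt0 _].
rewrite rmorphB rmorph1 /= comp_Xn_poly exprAC.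
set x := 'X^i.
have geo z : (1 - z *: x) * (\sum_(j < M.+1) (z *: x) ^+ j) = 1 - z ^+ M.+1 *: x ^+ M.+1.
  by rewrite -opprB mulNr -subrX1 opprB exprZn.
have geo1 z : eqX M.+1 ((1 - z *: x) * (\sum_(j < M.+1) (z *: x) ^+ j)) 1.
  rewrite geo /eqX addrAC subrr add0r dvdpNr -mul_polyC dvdp_mull //.
  by rewrite -exprM dvdp_exp2l // leq_pmull.
have fact : 1 - x ^+ 3 = (1 - x) * (1 - w *: x) * (1 - w ^+ 2 *: x).
  have w3 : w * w ^+ 2 = 1 by rewrite -exprS cube_root_of_unity.
  have -> : (1 - x) * (1 - w *: x) * (1 - w ^+ 2 *: x) =
     1 - (1 + w + w ^+ 2) *: x + (w + w ^+ 2 + w * w ^+ 2) *: x ^+ 2 - (w * w ^+ 2) *: x ^+ 3.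
    rewrite -!mul_polyC; ring.
  rewrite w3 w0 (_ : w + w ^+ 2 + 1 = 0) ?scale0r ?scale1r ?subr0 ?addr0 //.
  by rewrite -w0; ring.
rewrite fact; move: (geo1 w) (geo1 (w ^+ 2)).
move: (\sum_(j < _) _) (\sum_(j < _) _) (1 - w *: x) (1 - w ^+ 2 *: x) => b a c d ca db.
rewrite [X in eqX _ X _](_ : _ = (1 + x) ^+ 2 * (1 - x) * ((c * a) * (d * b))); last by ring.
rewrite -[X in eqX _ _ X]mulr1; apply: eqX_mul; first exact: eqX_refl.
by rewrite -[X in eqX _ _ X]mulr1; apply: eqX_mul.
Qed.

Lemma cubic_weighted_sum_eq0 (w : F) n : 1 + w + w ^+ 2 = 0 ->
  \sum_(p <- overpartition_pairs (3 * n + 2)) w ^+ n3 p.1 * (w ^+ 2) ^+ n3 p.2 = 0.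
Proof.
move=> w0; set N := (3 * n + 2)%N; have N_gt0 : (0 < N)%N by rewrite /N addn2.
have le_NM : (N <= 2 * N)%N by lia.
rewrite (perm_big _ (perm_overpartition_pairs le_NM le_NM)) /= -coef_gf_mul.
apply: (coef_cubic_quotient _ (gf_cubic_triangular N_gt0 w0)); last by lia.
  rewrite -horner_coef0 horner_prod big_nat big1 // => i /andP [i_gt0 _].
  by rewrite !hornerE expr0n gtn_eqF // subr0.
by move=> *; rewrite coef_triangular.
Qed.

(** As [w^2] is the inverse of [w], the weight of a pair is [w] to the power
    [r3]; the exponent [a + 2b] replaces [a - b] to stay in [nat]. *)
Lemma cubic_weighted_sum_R3 (w : F) n : 1 + w + w ^+ 2 = 0 ->
  \sum_(p <- overpartition_pairs n) w ^+ n3 p.1 * (w ^+ 2) ^+ n3 p.2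
   = (R3 0 3 n)%:R + (R3 1 3 n)%:R * w + (R3 2 3 n)%:R * w ^+ 2.
Proof.
move=> w0.
have w3 := cube_root_of_unity w0.
rewrite /R3 -!sum1_count !natr_sum !mulr_suml.
rewrite !(big_mkcond (fun p => eq_op _ _)) /= -!big_split /=.
apply: eq_bigr => -[l u] _; rewrite /r3 /= -exprM -exprD.
move: (n3 l) (n3 u) => a b.
have -> : w ^+ (a + 2 * b) = w ^+ ((a + 2 * b) %% 3).
  by rewrite {1}(divn_eq (a + 2 * b) 3) exprD mulnC exprM w3 expr1n mul1r.
have E s : (s < 3)%N -> (a%:Z - b%:Z == s%:Z %[mod 3%:Z])%Z = ((a + 2 * b) %% 3 == s)%N by lia.
rewrite !E //; have : ((a + 2 * b) %% 3 < 3)%N by rewrite ltn_mod.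
by case: (_ %% _)%N => [|[|[|]]] //= _; rewrite ?expr0 ?expr1 ?mul1r ?mul0r ?addr0 ?add0r.
Qed.

End Cubic.

(** * Equidistribution modulo 3 *)

Lemma R3_sum n : pp n = (R3 0 3 n + R3 1 3 n + R3 2 3 n)%N.
Proof.
rewrite /pp /R3 -!sum1_count !(big_mkcond (fun p => eq_op _ _)) /= -!big_split /= -sum1_size.
apply: eq_bigr => p _; move: (r3 p) => z.
by do 3 case: eqP => /=; lia.
Qed.

(** Subtracting the relations for [w] and [w^2] gives [(b - c) (w - w^2) = 0],
    so [b = c]; then [1 + w + w^2 = 0] turns the first one into [a - c = 0]. *)
Lemma R3_equidistributed n :
  (R3 0 3 (3 * n + 2) = R3 1 3 (3 * n + 2) /\ R3 1 3 (3 * n + 2) = R3 2 3 (3 * n + 2))%N.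
Proof.
have [w prim_w] := C_prim_root_exists (isT : (0 < 3)%N).
have w3 := prim_expr_order prim_w.
have w_neq1 : w - 1 != 0.
  by rewrite subr_eq0 -[w]expr1 -(prim_order_dvd prim_w).
have w0 : 1 + w + w ^+ 2 = 0.
  apply: (mulfI w_neq1); rewrite mulr0; transitivity (w ^+ 3 - 1); first by ring.
  by rewrite w3 subrr.
have w0' : 1 + w ^+ 2 + (w ^+ 2) ^+ 2 = 0.
  by rewrite -exprM (exprS w 3) w3 mulr1 addrAC.
have := cubic_weighted_sum_eq0 n w0; have := cubic_weighted_sum_eq0 n w0'.
rewrite !cubic_weighted_sum_R3 //.
rewrite -exprM (exprS w 3) w3 mulr1.
set a := R3 0 3 _; set b := R3 1 3 _; set c := R3 2 3 _ => sum2 sum1.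
have w_neq0 : w != 0.
  by apply: contra_eq_neq w3 => ->; rewrite expr0n eq_sym oner_eq0.
have bc : (b%:R : algC) = c%:R.
  have h : w - w ^+ 2 != 0.
    rewrite (_ : _ - _ = - (w * (w - 1))); last by ring.
    by rewrite oppr_eq0 mulf_neq0.
  apply: (mulIf h); apply/eqP; rewrite -subr_eq0; apply/eqP.
  transitivity ((a%:R + b%:R * w + c%:R * w ^+ 2) - (a%:R + b%:R * w ^+ 2 + c%:R * w)).
    by ring.
  by rewrite sum1 sum2 subrr.
have ac : (a%:R : algC) = c%:R.
  apply/eqP; rewrite -subr_eq0; apply/eqP.
  transitivity ((a%:R + b%:R * w + c%:R * w ^+ 2) - c%:R * (1 + w + w ^+ 2)).
    by rewrite bc; ring.
  by rewrite sum1 w0 mulr0 subrr.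
move/eqP: bc; move/eqP: ac; rewrite !eqr_nat => /eqP -> /eqP ->.
by [].
Qed.

Theorem theorem3p3 (s n : nat) (hs : (s <= 2)%N) :
  (R3 s 3 (3 * n + 2))%:R = (pp (3 * n + 2))%:R / 3%:R :> rat.
Proof.
have [e1 e2] := R3_equidistributed n.
have -> : R3 s 3 (3 * n + 2) = R3 2 3 (3 * n + 2).
  by case: s hs => [|[|[|]]] // _; rewrite ?e1.
by rewrite R3_sum e1 e2 !natrD; field.
Qed.
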